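(* Let $\ell$ be a line in $\mathbb{P}^n$ such that $\ell\cap\Delta_{n-2}=\emptyset$, and let $\mathbb{X}\subset\ell$ be a set of $m>n$ points with $\mathbb{X}\cap\Delta_{n-1}=\emptyset$. (i) If $[1:1:\cdots:1]\in\ell$, then the square-free Hadamard product $\mathbb{X}^{\underline{\star}n}$ is a Hadamard star configuration. (ii) If $n=2$, then $\mathbb{X}^{\underline{\star}2}$ is a Hadamard star configuration.
   Context: Let $S=\mathbb{C}[x_0,\ldots,x_n]$, let $S_1$ be the space of homogeneous linear forms, and $\mathbb{P}^n=\mathbb{P}^n_{\mathbb{C}}$. $V(\cdot)$ denotes the vanishing locus in $\mathbb{P}^n$, and for a nonzero $F\in S_1$, $[F]$ denotes its class in $\mathbb{P}S_1$. $\Delta_i\subset\mathbb{P}^n$ is the set of points with at most $i+1$ nonzero coordinates, i.e. with at least $n-i$ zero coordinates. For points $P=[a_0:\cdots:a_n]$, $Q=[b_0:\cdots:b_n]$ with $a_ib_i\ne 0$ for some $i$, the Hadamard product is $P\star Q=[a_0b_0:\cdots:a_nb_n]$; otherwise it is not defined. For a finite set $\mathbb{X}\subset\mathbb{P}^n$, the $r$-th square-free Hadamard product is $$\mathbb{X}^{\underline{\star}r}=\{P_1\star\cdots\star P_r \mid P_i\in\mathbb{X},\ P_i\ne P_j \text{ for } i\neq j\}.$$ A set $\mathcal{L}=\{L_1,\ldots,L_r\}\subset S_1$ is generally linear if $r\ge n+1$ and any $n+1$ distinct elements of $\mathcal{L}$ are linearly independent. For $1\le c\le n$ put $$\mathbb{X}_c(\mathcal{L})=\bigcup_{1\le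 i_1<\cdots<i_c\le r}V(L_{i_1},\ldots,L_{i_c})\subset\mathbb{P}^n;$$ if $\mathcal{L}$ is generally linear, $\mathbb{X}_c(\mathcal{L})$ is called a (codimension $c$) star configuration. A set $\mathcal{L}=\{L_1,\ldots,L_r\}\subset S_1$ is a Hadamard set if there exist $L=a_0x_0+\cdots+a_nx_n\in S_1$ and points $P_i=[p_0(i):\cdots:p_n(i)]\in\mathbb{P}^n\setminus\Delta_{n-1}$, $i=1,\dots,r$ (all coordinates nonzero), such that $[L_i]=\left[\frac{a_0}{p_0(i)}x_0+\cdots+\frac{a_n}{p_n(i)}x_n\right]\in\mathbb{P}S_1$ for all $i$. It is a strong Hadamard set if $L$ and the $P_i$ can be chosen so that in addition $\sum_{j=0}^n a_jp_j(i)=0$ for $i=1,\ldots,r$. A star configuration $\mathbb{X}_c(\mathcal{L})$ (so $\mathcal{L}$ is generally linear) is a Hadamard star configuration if $\mathcal{L}$ is a strong Hadamard set. Saying that a subset of $\mathbb{P}^n$ is a Hadamard star configuration means that it equals $\mathbb{X}_c(\mathcal{L})$ for some $c$ and some such $\mathcal{L}$.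
   Formalization: The formal theorem assumes n ≥ 2; for n = 1 part (i) is false, since in P^1 strongness forces all P_i to be equal, so no strong Hadamard set is generally linear (e.g. X = {[1:1],[1:2]}). *)

(* Defs.v *)
From HB Require Import structures.
From mathcomp Require Import all_boot all_order all_algebra.
From mathcomp Require Import complex.
From mathcomp Require Import boolp classical_sets functions cardinality reals.
(* The notations of mpoly clash with those of classical_sets. *)
From mathcomp Require Import -(notations) mpoly.

Set Implicit Arguments.
Unset Strict Implicit.
Unset Printing Implicit Defensive.

Import GRing.Theory.

Local Open Scope classical_set_scope.
Local Open Scope ring_scope.

(* The projectivization of [V]: its one-dimensional subspaces. *)
Record proj (K : fieldType) (V : vectType K) :=
  Proj { psub : {vspace V}; _ : \dim psub == 1%N }.
HB.instance Definition _ (K : fieldType) (V : vectType K) :=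
  [isSub for @psub K V].
HB.instance Definition _ (K : fieldType) (V : vectType K) :=
  [Choice of proj V by <:].

(* [None] exactly when [v = 0]. *)
Definition pclass (K : fieldType) (V : vectType K) (v : V) : option (proj V) :=
  insub <[v]>%VS.

Notation pspace K n := (proj 'rV[K]_n.+1).

(* [dhomog n.+1 K d] has a canonical [vectType K] structure. *)
Notation linform K n := (dhomog n.+1 K 1).

Section Hadamard.
Variables (K : fieldType) (n : nat).
Implicit Types (P Q : pspace K n) (X : set (pspace K n)) (L : linform K n).

(* A choice of homogeneous coordinates. The notions stated below with [hcoord]
   do not depend on this choice. *)
Definition hcoord P : 'rV[K]_n.+1 := vpick (psub P).

Lemma dim_ones : \dim <[const_mx 1 : 'rV[K]_n.+1]>%VS == 1%N.
Proof.
suff nz : (const_mx 1 : 'rV[K]_n.+1) != 0 by rewrite dim_vline nz.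
by apply/eqP => /rowP/(_ 0)/eqP; rewrite !mxE oner_eq0.
Qed.

Definition pones : pspace K n := Proj dim_ones.

Definition is_line (l : set (pspace K n)) : Prop :=
  exists2 W : {vspace 'rV[K]_n.+1},
    \dim W = 2%N & l = [set P | (psub P <= W)%VS].

Definition Delta (i : nat) : set (pspace K n) :=
  [set P | (#|[pred j | hcoord P 0%R j != 0%R]| <= i.+1)%N].

(* [None] exactly when all the products of coordinates vanish. *)
Definition hadamard P Q : option (pspace K n) :=
  pclass (\row_j (hcoord P 0 j * hcoord Q 0 j)).

(* Undefined as soon as some partial product is; a product has at least one
   factor. *)
Definition hadamard_prod (s : seq (pspace K n)) : option (pspace K n) :=
  if s is P :: s' then
    foldl (fun o Q => obind (hadamard^~ Q) o) (Some P) s'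
  else None.

Definition sqfree_hadamard (r : nat) X : set (pspace K n) :=
  [set Q | exists s : r.-tuple (pspace K n),
    [/\ uniq s, (forall P, P \in s -> X P) & hadamard_prod s = Some Q]].

Lemma dhomog_var (j : 'I_n.+1) :
  (mpolyX K (mnm1 j) : mpoly n.+1 K) \is @ishomog1 n.+1 K 1 mdeg.
Proof. by rewrite dhomogX; apply/eqP; exact: mdeg1. Qed.

Definition var (j : 'I_n.+1) : linform K n := DHomog (dhomog_var j).

Definition lcoef L (j : 'I_n.+1) : K := mcoeff (mnm1 j) (mpoly_of_dhomog L).

Definition vanishes L P : Prop := meval (hcoord P 0) (mpoly_of_dhomog L) = 0.

Section Family.
Variables (r : nat) (L : 'I_r -> linform K n).

(* [L] enumerates a set of [r] linear forms. *)
Definition generally_linear : Prop :=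
  [/\ injective L, (n.+1 <= r)%N
    & forall I : {set 'I_r}, #|I| = n.+1 -> free [seq L i | i in I]].

Definition star_locus (c : nat) : set (pspace K n) :=
  [set P | exists2 I : {set 'I_r},
    #|I| = c & forall i, i \in I -> vanishes (L i) P].

(* [M] and the points [P i] witness that [L] is a Hadamard set. In the first
   clause, [pclass (L i)] must be defined, i.e. [L i != 0]. *)
Definition hadamard_witness (M : linform K n) (P : 'I_r -> pspace K n) : Prop :=
  forall i, (~ Delta (n - 1) (P i)) /\
    exists2 C : proj (linform K n), pclass (L i) = Some C &
      pclass (\sum_j (lcoef M j / hcoord (P i) 0 j) *: var j) = Some C.

Definition strong_hadamard_set : Prop :=
  exists (M : linform K n) (P : 'I_r -> pspace K n), hadamard_witness M P /\
    forall i, \sum_j lcoef M j * hcoord (P i) 0 j = 0.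

End Family.

Definition hadamard_star_configuration X : Prop :=
  exists (c r : nat) (L : 'I_r -> linform K n),
    [/\ (1 <= c <= n)%N, generally_linear L, strong_hadamard_set L
      & X = star_locus L c].

End Hadamard.

(* Main.v *)
(* Choose e and u spanning the line, with all coordinates of e nonzero and e off
   the given points, so that up to scalars P_i = (e_j (z_j - y_i))_j with
   z_j = u_j / e_j. At most one coordinate of a point of the line vanishes, so the
   z_j are distinct. Writing x_j = e_j^n h(z_j) identifies vectors x with
   polynomials h of degree at most n, and the product of the points P_i, i in I,
   with |I| = n, is the h = prod_(i in I) (X - y_i) up to a scalar, i.e. the h
   vanishing at the y_i, i in I. By Lagrange interpolation, h(y_i) is
   proportional to sum_j b_j / p_j(i) x_j, where p_j(i) is the j-th coordinate of
   P_i and b_j is the barycentric weight of z_j divided by e_j^(n-1). Strongness,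
   sum_j b_j p_j(i) = 0, holds because barycentric weights annihilate polynomials
   of degree less than n: when a vector q of the plane has q_j^(n-2) = 1 for all
   j, the factor e_j^(2-n) in b_j p_j(i) is a polynomial of degree at most n - 2
   in z_j. *)
Require Import Defs.
From mathcomp Require Import all_boot all_order all_algebra.
From mathcomp Require Import complex.
From mathcomp Require Import boolp classical_sets functions cardinality reals.
From mathcomp Require Import -(notations) mpoly.
From mathcomp Require Import ring.

Set Implicit Arguments.
Unset Strict Implicit.
Unset Printing Implicit Defensive.

Import GRing.Theory Num.Theory.

Local Open Scope classical_set_scope.
Local Open Scope ring_scope.

(** * Lagrange interpolation and barycentric weights at [n.+1] distinct nodes *)

Section Interpolation.
Variables (K : fieldType) (n : nat) (z : 'I_n.+1 -> K).
Hypothesis z_inj : injective z.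
Implicit Types (h : {poly K}) (y : K).

(** Unnormalised Lagrange basis polynomial: its value at its own node [z j] is the inverse of the
    barycentric weight. *)
Definition node_poly (j : 'I_n.+1) : {poly K} :=
  \prod_(k | k != j) ('X - (z k)%:P).

Definition weight (j : 'I_n.+1) : K := (\prod_(k | k != j) (z j - z k))^-1.

Lemma weight_neq0 j : weight j != 0.
Proof.
rewrite invr_eq0; apply/prodf_neq0 => k kj.
by rewrite subr_eq0 (inj_eq z_inj) eq_sym.
Qed.

Lemma size_node_poly j : size (node_poly j) = n.+1.
Proof.
rewrite /node_poly (eq_bigl (mem (predC1 j))) // -big_enum size_prod_XsubC.
by rewrite -cardE cardC1 card_ord.
Qed.

Lemma horner_node_poly j y : (node_poly j).[y] = \prod_(k | k != j) (y - z k).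
Proof. by rewrite horner_prod; apply: eq_bigr => k _; rewrite hornerXsubC. Qed.

Lemma horner_node_poly_node j k :
  (node_poly j).[z k] = (k == j)%:R / weight j.
Proof.
rewrite horner_node_poly; have [->|kj] := eqVneq k j.
  by rewrite mul1r /weight invrK.
by rewrite (bigD1 k) //= subrr !mul0r.
Qed.

Lemma poly_nodes_eq0 h :
  (size h <= n.+1)%N -> (forall j, h.[z j] = 0) -> h = 0.
Proof.
move=> sh h0; apply: (@roots_geq_poly_eq0 _ _ (codom z)).
- by apply/allP => _ /codomP[j ->]; apply/eqP.
- by rewrite map_inj_uniq ?enum_uniq.
- by rewrite size_codom card_ord.
Qed.

Lemma size_interpolant (c : 'I_n.+1 -> K) :
  (size (\sum_j c j *: node_poly j)%R <= n.+1)%N.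
Proof.
apply: (leq_trans (size_sum _ _ _)); apply/bigmax_leqP => j _.
by rewrite (leq_trans (size_scale_leq _ _)) ?size_node_poly.
Qed.

Lemma interpolant_node (x : 'I_n.+1 -> K) k :
  (\sum_j (weight j * x j) *: node_poly j).[z k] = x k.
Proof.
rewrite horner_sum (bigD1 k) //= big1 => [|j jk].
  rewrite addr0 hornerZ horner_node_poly_node eqxx mul1r mulrAC.
  by rewrite divff ?mul1r ?weight_neq0.
by rewrite hornerZ horner_node_poly_node eq_sym (negPf jk) mul0r mulr0.
Qed.

(** Both sides have degree at most [n] and agree at [n.+1] distinct nodes. *)
Lemma lagrange_interpolation h : (size h <= n.+1)%N ->
  h = \sum_j (weight j * h.[z j]) *: node_poly j.
Proof.
move=> sh; apply/eqP; rewrite -subr_eq0; apply/eqP/poly_nodes_eq0 => [|j].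
  rewrite (leq_trans (size_polyD _ _)) // geq_max sh size_polyN.
  exact: size_interpolant.
by rewrite hornerD hornerN interpolant_node subrr.
Qed.

(** Off the nodes, [(node_poly j).[y]] is the full product of the [y - z k] divided by [y - z j];
    this turns the Lagrange formula into the barycentric one. *)
Lemma horner_barycentric h y : (size h <= n.+1)%N -> (forall j, y != z j) ->
  h.[y] = (\prod_j (y - z j)) * \sum_j weight j * h.[z j] / (y - z j).
Proof.
move=> sh yz; rewrite {1}(lagrange_interpolation sh) horner_sum mulr_sumr.
apply: eq_bigr => j _; rewrite hornerZ horner_node_poly.
rewrite [X in _ = X * _](bigD1 j) //=; field.
by rewrite subr_eq0.
Qed.

(** Each [node_poly j] is monic of degree [n], so the sum is the coefficient of degree [n] in the
    Lagrange formula for [h]. *)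
Lemma sum_weight_horner h : (size h <= n)%N -> \sum_j weight j * h.[z j] = 0.
Proof.
move=> sh; rewrite -[RHS](nth_default 0 sh).
rewrite [in RHS](lagrange_interpolation (leqW sh)) coef_sum.
apply: eq_bigr => j _; rewrite coefZ.
have /monicP : node_poly j \is monic by apply: monic_prod => k _; apply: monicXsubC.
by rewrite lead_coefE size_node_poly /= => ->; rewrite mulr1.
Qed.

End Interpolation.

(** * The linear forms attached to the points, and their values at products of points *)

Section Forms.
Variables (K : fieldType) (n r : nat).
Variables (z e : 'I_n.+1 -> K) (y t : 'I_r -> K).
Hypotheses (z_inj : injective z) (y_inj : injective y).
Hypotheses (e_neq0 : forall j, e j != 0) (t_neq0 : forall i, t i != 0).
Hypothesis yz : forall i j, y i != z j.

(* Coordinates of the points t_i (u - y_i e) on the line through e and u, where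
   u_j = z_j e_j. *)
Definition pt i j : K := t i * e j * (z j - y i).
(* For [0 < n] this is [weight z j / e j ^+ n.-1]. *)
Definition base_coef j : K := weight z j * e j / e j ^+ n.

Lemma base_coef_neq0 j : base_coef j != 0.
Proof.
by rewrite /base_coef mulf_neq0 ?invr_neq0 ?expf_neq0 // mulf_neq0 // weight_neq0.
Qed.

Definition lform_at i (x : 'I_n.+1 -> K) := \sum_j base_coef j / pt i j * x j.

(** By the barycentric formula the value of the form is [h.[y i]] times the nonzero factor -1 / (t_i
    prod_j (y_i - z_j)). *)
Lemma lform_at_eq0 i (h : {poly K}) : (size h <= n.+1)%N ->
  (lform_at i (fun j => e j ^+ n * h.[z j]) == 0) = (h.[y i] == 0).
Proof.
move=> sh; rewrite (horner_barycentric z_inj sh) // mulf_eq0 prodf_seq_eq0.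
rewrite (introF hasP) => [|[j _ /=]]; last by rewrite subr_eq0 (negPf (yz _ _)).
have -> : lform_at i (fun j => e j ^+ n * h.[z j]) =
   - (t i)^-1 * \sum_j weight z j * h.[z j] / (y i - z j).
  rewrite mulr_sumr; apply: eq_bigr => j _.
  rewrite /base_coef /pt; set E := e j ^+ n.
  have E0 : E != 0 by rewrite expf_neq0.
  have := yz i j; rewrite -subr_eq0 => d1.
  have := d1; rewrite -oppr_eq0 opprB => d2.
  by field; rewrite ?d1 ?d2 ?t_neq0 ?e_neq0 ?E0.
by rewrite mulf_eq0 oppr_eq0 invr_eq0 (negPf (t_neq0 i)).
Qed.

Definition prod_pt (s : seq 'I_r) j := \prod_(i <- s) pt i j.

Definition root_poly (s : seq 'I_r) : {poly K} := \prod_(i <- s) ('X - (y i)%:P).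

Lemma size_root_poly s : size (root_poly s) = (size s).+1.
Proof. by rewrite /root_poly size_prod_XsubC. Qed.

Lemma root_poly_eq0 s i : ((root_poly s).[y i] == 0) = (i \in s).
Proof.
rewrite -/(root _ _) /root_poly -(big_map y predT (fun c => 'X - c%:P)).
by rewrite root_prod_XsubC mem_map.
Qed.

Lemma prod_ptE s j : size s = n ->
  prod_pt s j = (\prod_(i <- s) t i) * (e j ^+ n * (root_poly s).[z j]).
Proof.
move=> <-; rewrite /prod_pt /root_poly; elim: s => [|i s IH].
  by rewrite !big_nil expr0 hornerC !mulr1.
rewrite !big_cons hornerM hornerXsubC IH /pt /= exprS; ring.
Qed.

Lemma interpolate (x : 'I_n.+1 -> K) :
  exists2 h : {poly K}, (size h <= n.+1)%N & forall j, x j = e j ^+ n * h.[z j].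
Proof.
exists (\sum_j (weight z j * (x j / e j ^+ n)) *: node_poly z j).
  exact: size_interpolant.
by move=> j; rewrite (interpolant_node z_inj) mulrC divfK ?expf_neq0.
Qed.

Lemma eq_lform_at i x x' : x =1 x' -> lform_at i x = lform_at i x'.
Proof. by move=> xx; apply: eq_bigr => j _; rewrite xx. Qed.

Lemma lform_atZ i k x : lform_at i (fun j => k * x j) = k * lform_at i x.
Proof. by rewrite mulr_sumr; apply: eq_bigr => j _; rewrite mulrCA. Qed.

Lemma lform_at_prod_pt s i : size s = n -> i \in s -> lform_at i (prod_pt s) = 0.
Proof.
move=> sn si; rewrite (eq_lform_at i (fun j => prod_ptE j sn)) lform_atZ.
apply/eqP; rewrite mulf_eq0 lform_at_eq0 ?size_root_poly ?sn //.
by rewrite root_poly_eq0 si orbT.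
Qed.

(** The polynomial interpolating [x] has degree at most [n] and vanishes at the [n] distinct [y i],
    so it is a constant multiple of [root_poly s]. *)
Lemma common_zero_prod_pt s x : size s = n -> uniq s ->
  (forall i, i \in s -> lform_at i x = 0) ->
  exists k, forall j, x j = k * prod_pt s j.
Proof.
move=> sn us sx; have [h sh hx] := interpolate x.
have /uniq_roots_prod_XsubC : all (root h) (map y s).
  apply/allP => _ /mapP[i si ->]; rewrite /root -lform_at_eq0 //.
  by rewrite -(eq_lform_at i hx) sx.
rewrite uniq_rootsE map_inj_uniq // us big_map => /(_ isT)[g hE].
have g1 : (size g <= 1)%N.
  have [->|g0] := eqVneq g 0; first by rewrite size_poly0.
  have p0 : root_poly s != 0 by rewrite -size_poly_eq0 size_root_poly.
  have := sh; rewrite hE size_mul // -?/(root_poly s) // size_root_poly sn.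
  by rewrite addnS /= -[X in (_ <= X)%N]add1n leq_add2r.
have T0 : \prod_(i <- s) t i != 0.
  by rewrite prodf_seq_neq0; apply/allP => i _ /=; apply: t_neq0.
exists (g`_0 / \prod_(i <- s) t i) => j.
rewrite hx prod_ptE // hE (size1_polyC g1) hornerM hornerC coefC /= -/(root_poly s).
by field.
Qed.

(** Evaluate the relation at the vector given by the root polynomial of [s] without [i]: every form
    of [s] vanishes there except the one of index [i]. *)
Lemma lform_free s (c : 'I_r -> K) : uniq s -> size s = n.+1 ->
  (forall j, \sum_(i <- s) c i * (base_coef j / pt i j) = 0) ->
  forall i, i \in s -> c i = 0.
Proof.
move=> us sn c0 i si.
have sr : size (rem i s) = n by rewrite size_rem // sn.
pose h := root_poly (rem i s).
have sh : (size h <= n.+1)%N by rewrite size_root_poly sr.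
have: \sum_(k <- s) c k * lform_at k (fun j => e j ^+ n * h.[z j]) = 0.
  under eq_bigr do rewrite mulr_sumr.
  rewrite exchange_big big1 //= => j _.
  by under eq_bigr do rewrite mulrA; rewrite -mulr_suml c0 mul0r.
rewrite (bigD1_seq i) //= big1_seq ?addr0.
  move/eqP; rewrite mulf_eq0 => /orP[/eqP //|].
  by rewrite lform_at_eq0 // root_poly_eq0 mem_rem_uniq // inE eqxx.
move=> k /andP[ki sk]; apply/eqP; rewrite mulf_eq0 lform_at_eq0 // root_poly_eq0.
by rewrite mem_rem_uniq // inE ki sk orbT.
Qed.

(** The hypothesis turns the inverse of e_j^(n-2) into (q0 + q1 z_j)^(n-2). The summand is then
    [weight z j] times the value at [z j] of a polynomial of degree at most n - 1, and
    [sum_weight_horner] applies. *)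
Lemma sum_base_coef_pt (q0 q1 : K) i : (2 <= n)%N ->
  (forall j, (e j * (q0 + q1 * z j)) ^+ (n - 2) = 1) ->
  \sum_j base_coef j * pt i j = 0.
Proof.
move=> n2 q1P.
pose h := (t i)%:P * ('X - (y i)%:P) * (q0%:P + q1%:P * 'X) ^+ (n - 2).
have sz1 : (size (q0%:P + q1%:P * 'X)%R <= 2)%N.
  apply: (leq_trans (size_polyD _ _)); rewrite geq_max.
  rewrite (leq_trans (size_polyC_leq1 _)) //=.
  by rewrite mul_polyC (leq_trans (size_scale_leq _ _)) ?size_polyX.
rewrite -[RHS](@sum_weight_horner _ _ z z_inj h).
  apply: eq_bigr => j _; rewrite !hornerE /base_coef /pt.
  have E0 : e j ^+ (n - 2) != 0 by rewrite expf_neq0.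
  have -> : (q0 + q1 * z j) ^+ (n - 2) = (e j ^+ (n - 2))^-1.
    by apply: (mulfI E0); rewrite -exprMn q1P divff.
  rewrite -[X in e j ^+ X](subnK n2) exprD.
  by move: (e j ^+ (n - 2)) E0 => E E0 /=; field; rewrite E0 e_neq0.
apply: (leq_trans (size_polyMleq _ _)).
rewrite mul_polyC.
have a1 : (size (t i *: ('X - (y i)%:P))%R <= 2)%N.
  by rewrite (leq_trans (size_scale_leq _ _)) ?size_XsubC.
have a2 : (size ((q0%:P + q1%:P * 'X) ^+ (n - 2))%R <= (n - 2).+1)%N.
  apply: (leq_trans (size_poly_exp_leq _ _)); rewrite ltnS.
  by rewrite -[X in (_ <= X)%N]mul1n leq_mul // -subn1 leq_subLR.
by rewrite -subn1 leq_subLR (leq_trans (leq_add a1 a2)) // addnS subnKC.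
Qed.

End Forms.

(** * Points of a projective space and their representatives *)

Section Proj.
Variables (K : fieldType) (V : vectType K).
Implicit Types (A B : proj V) (v : V).

(* On [pspace K n] this is convertible to [hcoord]. *)
Definition prep A : V := vpick (psub A).

Lemma prep_neq0 A : prep A != 0.
Proof. by rewrite vpick0 -dimv_eq0 (eqP (valP A)). Qed.

Lemma psub_prep A : psub A = <[prep A]>%VS.
Proof.
apply/eqP; rewrite eq_sym eqEdim -memvE memv_pick /=.
by rewrite (eqP (valP A)) dim_vline prep_neq0.
Qed.

Lemma pclass_Some v A :
  pclass v = Some A <-> exists2 k, k != 0 & prep A = k *: v.
Proof.
split.
  rewrite /pclass; case: insubP => // B _ Bv [<-].
  have := memv_pick (psub B); rewrite {2}[psub B]Bv => /vlineP[k kE].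
  exists k => //; apply: contraNneq (prep_neq0 B) => k0.
  by rewrite /prep kE k0 scale0r.
case=> k k0 kE; have Av : psub A = <[v]>%VS.
  have v0 : v != 0.
    by apply: contraNneq (prep_neq0 A) => v0; rewrite kE v0 scaler0.
  apply/eqP; rewrite psub_prep eqEdim -memvE kE memvZ ?memv_line //=.
  by rewrite !dim_vline v0 scaler_eq0 negb_or k0 v0.
by rewrite /pclass -Av -[psub A]/(val A) valK.
Qed.

Lemma pclassZ k v : k != 0 -> pclass (k *: v) = pclass v.
Proof.
move=> k0; congr insub; apply/eqP; rewrite eqEsubv -!memvE.
rewrite memvZ ?memv_line //=; apply/vlineP; exists k^-1.
by rewrite scalerA mulVf ?scale1r.
Qed.

Lemma pclass_prep A : pclass (prep A) = Some A.
Proof. by apply/pclass_Some; exists 1; rewrite ?oner_neq0 ?scale1r. Qed.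

Lemma pclass_neq0 v : v != 0 -> exists A, pclass v = Some A.
Proof.
move=> v0; have d1 : \dim <[v]> == 1%N by rewrite dim_vline v0.
by exists (Proj d1); rewrite /pclass insubT.
Qed.

Lemma pclass0 : pclass (0 : V) = None.
Proof.
case E: (pclass _) => [A|//]; move/pclass_Some: E => [k _ /eqP].
by rewrite scaler0 (negPf (prep_neq0 A)).
Qed.

Lemma proj_eq A B k : prep A = k *: prep B -> A = B.
Proof.
move=> AB; have k0 : k != 0.
  by apply: contraNneq (prep_neq0 A) => k0; rewrite AB k0 scale0r.
by have := pclass_prep A; rewrite AB pclassZ // pclass_prep => -[].
Qed.

Lemma plane_decomposition (W : {vspace V}) e u : \dim W = 2%N ->
  e \in W -> u \in W -> e != 0 -> u \notin <[e]>%VS ->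
  forall w, w \in W -> exists s t, w = s *: e + t *: u.
Proof.
move=> W2 eW uW e0 ue w; suff -> : W = (<[e]> + <[u]>)%VS.
  by move=> /memv_addP[_ /vlineP[s ->] [_ /vlineP[t ->] ->]]; exists s, t.
apply/esym/eqP; rewrite eqEdim subv_add -!memvE eW uW /= W2.
rewrite dimv_disjoint_sum; last first.
  apply/eqP; rewrite -subv0; apply/subvP => x.
  rewrite memv_cap => /andP[xe /vlineP[k xk]]; rewrite memv0 xk.
  apply: contraR ue; rewrite scaler_eq0 negb_or => /andP[k0 _].
  by have := memvZ k^-1 xe; rewrite xk scalerA mulVf // scale1r.
have u0 : u != 0 by apply: contraNneq ue => ->; rewrite mem0v.
by rewrite !dim_vline e0 u0.
Qed.

End Proj.

(** * Linear forms given by their coefficients *)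

Section LinearForms.
Variables (K : fieldType) (n : nat).
Implicit Types (c : 'I_n.+1 -> K).

Definition lform c : linform K n := \sum_j c j *: var K j.

Lemma lcoef_lform c j : lcoef (lform c) j = c j.
Proof.
rewrite /lcoef raddf_sum raddf_sum (bigD1 j) //= big1 => [|k kj].
  by rewrite addr0 mcoeffZ mcoeffX eqxx mulr1.
by rewrite mcoeffZ mcoeffX eq_mnm1 (negPf kj) mulr0.
Qed.

Lemma vanishes_lform c (Q : pspace K n) :
  vanishes (lform c) Q <-> \sum_j c j * hcoord Q 0 j = 0.
Proof.
rewrite /vanishes raddf_sum raddf_sum /=.
by under eq_bigr do rewrite mevalZ mevalXU.
Qed.

Lemma lform_eq0 c : lform c = 0 -> forall j, c j = 0.
Proof. by move=> c0 j; rewrite -lcoef_lform c0 /lcoef !raddf0. Qed.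

Lemma lform_sum (I : Type) (s : seq I) (k : I -> K) (c : I -> 'I_n.+1 -> K) :
  \sum_(i <- s) k i *: lform (c i) = lform (fun j => \sum_(i <- s) k i * c i j).
Proof.
under eq_bigr do rewrite scaler_sumr.
rewrite exchange_big; apply: eq_bigr => j _.
by rewrite scaler_suml; apply: eq_bigr => i _; rewrite scalerA.
Qed.

End LinearForms.

Lemma free_map_uniq (K : fieldType) (V : vectType K) (I : eqType) (s : seq I)
    (f : I -> V) : uniq s ->
  (forall c : I -> K, \sum_(i <- s) c i *: f i = 0 ->
    forall i, i \in s -> c i = 0) ->
  free [seq f i | i <- s].
Proof.
move=> us sP; case: s us sP => [|x0 s0]; first by rewrite nil_free.
set s := x0 :: s0 => us sP.
have sz i : (i < size (map f s))%N -> (i < size s)%N by rewrite size_map.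
apply/(@freeP _ _ _ (in_tuple [seq f i | i <- s])) => k k0 i.
(* Transports the coefficients from positions to elements of [s], with default 0 outside [s]; well
   defined because [s] has no repetition. *)
pose c j := if insub (index j s) is Some i' then k i' else 0.
have cE (i' : 'I_(size (map f s))) : c (nth x0 s i') = k i'.
  by rewrite /c index_uniq ?sz //= insubT // => ?; congr k; apply: val_inj.
rewrite -cE; apply: sP; last by rewrite mem_nth ?sz.
rewrite (big_nth x0) big_mkord -[RHS]k0 -(size_map f).
by apply: eq_bigr => j _; rewrite cE (nth_map x0) ?sz.
Qed.

(** * Hadamard products in coordinates, and the sets Delta *)

Section HadamardProducts.
Variables (K : fieldType) (n : nat).
Implicit Types (A Q : pspace K n) (s : seq (pspace K n)) (v : 'rV[K]_n.+1).

Lemma hadamard_pclass v Q :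
  obind (fun A => hadamard A Q) (pclass v) =
  pclass (\row_j (v 0 j * hcoord Q 0 j)).
Proof.
have [->|/pclass_neq0[A vA]] := eqVneq v 0.
  rewrite pclass0 /= (_ : \row_j _ = 0) ?pclass0 //.
  by apply/rowP => j; rewrite !mxE mul0r.
rewrite vA /=; move/pclass_Some: vA => [k k0 kE].
rewrite /hadamard -(pclassZ (\row_j (v 0 j * hcoord Q 0 j)) k0).
by congr pclass; apply/rowP => j; rewrite !mxE -[hcoord A]/(prep A) kE mxE mulrA.
Qed.

(** A partial product is undefined when its coordinate vector is zero, and then the full product
    vector is zero too, so both sides are [None] together. *)
Lemma hadamard_prodE s : s != [::] ->
  hadamard_prod s = pclass (\row_j \prod_(A <- s) hcoord A 0 j).
Proof.
case: s => // A s _; rewrite /hadamard_prod -(pclass_prep A).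
have -> : \row_j \prod_(B <- A :: s) hcoord B 0 j =
          \row_j (prep A 0 j * \prod_(B <- s) hcoord B 0 j) :> 'rV[K]_n.+1.
  by apply/rowP => j; rewrite !mxE big_cons.
elim: s (prep A) => [|B s IH] v /=.
  by congr pclass; apply/rowP => j; rewrite !mxE big_nil mulr1.
rewrite hadamard_pclass IH; congr pclass; apply/rowP => j.
by rewrite !mxE big_cons mulrA.
Qed.

(** Coordinatewise products ignore order, so tuples of distinct points may be replaced by sets of
    [m] indices. *)
Lemma sqfree_hadamard_range m r (P : 'I_r -> pspace K n) Q : injective P ->
  (0 < m)%N ->
  sqfree_hadamard m (range P) Q <->
  exists2 I : {set 'I_r}, #|I| = m &
    pclass (\row_j \prod_(i <- enum I) hcoord (P i) 0 j) = Some Q.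
Proof.
move=> P_inj m0; split=> [[s [us sP sQ]]|[I Im IQ]].
  pose I := [set i | P i \in val s]%SET.
  have sI : perm_eq (map P (enum I)) s.
    apply: uniq_perm => //; first by rewrite map_inj_uniq ?enum_uniq.
    move=> A; apply/mapP/idP => [[i + ->]|sA]; first by rewrite mem_enum finset.inE.
    by have [i _ PA] := sP _ sA; exists i; rewrite ?mem_enum ?finset.inE PA.
  exists I; first by rewrite cardE -(size_map P) (perm_size sI) size_tuple.
  rewrite -sQ hadamard_prodE; last by rewrite -size_eq0 size_tuple -lt0n.
  congr pclass; apply/rowP => j; rewrite !mxE -(perm_big _ sI) /=.
  by rewrite big_map.
have sI : size (map P (enum I)) == m by rewrite size_map -cardE Im.
exists (Tuple sI); split => /=.
- by rewrite map_inj_uniq ?enum_uniq.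
- by move=> _ /mapP[i _ ->]; exists i.
rewrite hadamard_prodE; last by rewrite -size_eq0 (eqP sI) -lt0n.
by rewrite -IQ; congr pclass; apply/rowP => j; rewrite !mxE big_map.
Qed.

Lemma not_Delta_n1 A : (0 < n)%N ->
  ~ Delta (n - 1) A <-> forall j, hcoord A 0 j != 0.
Proof.
move=> n0; rewrite /Delta /= subn1 prednK //; split=> [nA j|A0].
  apply: contra_notN nA => /eqP Aj.
  have sub : [pred j | hcoord A 0 j != 0] \subset predC1 j.
    by apply/fintype.subsetP => k; rewrite !inE; apply: contraNneq => ->; rewrite Aj.
  by have := subset_leq_card sub; rewrite cardC1 card_ord.
apply/negP; rewrite -ltnNge -[X in (X <= _)%N](card_ord n.+1).
by apply/subset_leq_card/fintype.subsetP => j _; rewrite inE A0.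
Qed.

Lemma not_Delta_n2 A j k : (1 < n)%N -> ~ Delta (n - 2) A -> j != k ->
  hcoord A 0 j = 0 -> hcoord A 0 k != 0.
Proof.
move=> n1 nA jk Aj; apply: contra_notN nA => /eqP Ak; rewrite /Delta /=.
have sub : [pred j | hcoord A 0 j != 0] \subset predC (pred2 j k).
  apply/fintype.subsetP => i; rewrite !inE; apply: contraNN => /orP[] /eqP ->.
    by rewrite Aj.
  by rewrite Ak.
apply: (leq_trans (subset_leq_card sub)).
by rewrite -(leq_add2l #|pred2 j k|) cardC card2 jk card_ord addnS subnKC.
Qed.

End HadamardProducts.

(** In characteristic zero the first [(size s).+1] natural numbers are distinct, too many to lie all
    in [s]. *)
Lemma fresh_scalar (K : numFieldType) (s : seq K) : exists c, c \notin s.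
Proof.
apply: contrapT => all_s.
pose t := [seq k%:R : K | k <- iota 0 (size s).+1].
have ut : uniq t.
  by rewrite map_inj_uniq ?iota_uniq // => a b /eqP; rewrite eqr_nat => /eqP.
have /(uniq_leq_size ut) : {subset t <= s}.
  by move=> c _; apply: contrapT => cs; apply: all_s; exists c; apply/negP.
by rewrite size_map size_iota ltnn.
Qed.

Lemma enum_card_eq (T : Type) (X : set T) m : (X #= `I_m)%card ->
  exists2 P : 'I_m -> T, injective P & X = range P.
Proof.
move=> /card_set_bijP[f [fX f_inj f_surj]].
have /choice[P PE] (i : 'I_m) : exists A, X A /\ f A = i.
  by have [A XA fA] := f_surj i (ltn_ord i); exists A.
exists P => [i i' PP|].
  by apply: val_inj; rewrite /= -(PE i).2 PP (PE i').2.
apply/seteqP; split=> [A XA|_ [i _ <-]]; last by have [] := PE i.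
exists (Ordinal (fX _ XA)) => //; apply: f_inj; rewrite ?inE //.
  by have [] := PE (Ordinal (fX _ XA)).
by have [_ ->] := PE (Ordinal (fX _ XA)).
Qed.

(** * Affine coordinates on the line and the star configuration *)

Section PointsOnLine.
Variables (K : numFieldType) (n r : nat) (W : {vspace 'rV[K]_n.+1}).
(* [q1] covers both parts: take q = (1, ..., 1) in (i), and any point of the set
   when n = 2. *)
Variables (P : 'I_r -> pspace K n) (q : 'rV[K]_n.+1).
Hypotheses (n2 : (2 <= n)%N) (nr : (n < r)%N) (W2 : \dim W = 2%N).
Hypothesis W_coord : forall w j k, w \in W -> j != k ->
  w 0 j = 0 -> w 0 k = 0 -> w = 0.
Hypotheses (P_inj : injective P) (PW : forall i, hcoord (P i) \in W).
Hypothesis P_neq0 : forall i j, hcoord (P i) 0 j != 0.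
Hypotheses (qW : q \in W) (q1 : forall j, q 0 j ^+ (n - 2) = 1).

(* A base point e off the given points puts all of them in the affine chart
   u - y e of the line; the vector 1 itself may be one of the points. *)
Lemma chart : exists e u : 'rV[K]_n.+1,
  [/\ e \in W, u \in W, u \notin <[e]>%VS, forall j, e 0 j != 0
    & forall i, hcoord (P i) \notin <[e]>%VS].
Proof.
pose u := hcoord (P (Ordinal nr)).
have u0 : u != 0 := prep_neq0 _.
have [v vW vu] : exists2 v, v \in W & v \notin <[u]>%VS.
  apply/subvPn; apply/negP => /dimvS; rewrite W2 dim_vline u0.
  by [].
have /choice[a aP] i : exists ab : K * K, hcoord (P i) = ab.1 *: u + ab.2 *: v.
  have [a [b ->]] := plane_decomposition W2 (PW _) vW u0 vu (PW i).
  by exists (a, b).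
(* The first list holds the [c] for which [v + c *: u] has a zero coordinate, the second those for
   which it represents some [P i]. A zero denominator only excludes the value 0 as well. *)
have [c] := fresh_scalar ([seq - v 0 j / u 0 j | j <- enum 'I_n.+1] ++
                          [seq (a i).1 / (a i).2 | i <- enum 'I_r]).
rewrite mem_cat negb_or => /andP[c1 c2].
have Pe i : hcoord (P i) \notin <[v + c *: u]>%VS.
  apply: contra c2 => /vlineP[k]; rewrite aP => kE.
  (* Otherwise the coefficients of [v] differ and [v] would be a multiple of [u]. *)
  have bk : (a i).2 = k.
    apply/eqP; rewrite -subr_eq0; apply: contraNT vu => d0.
    apply/vlineP; exists (((a i).2 - k)^-1 * (k * c - (a i).1)).
    rewrite -scalerA scalerBl -scalerA.
    have -> : k *: (c *: u) - (a i).1 *: u = ((a i).2 - k) *: v.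
      apply/eqP; rewrite scalerBl subr_eq addrAC -subr_eq opprK eq_sym addrC kE.
      by rewrite scalerDr addrC.
    by rewrite scalerA mulVf ?scale1r.
  have k0 : k != 0.
    apply: contraNneq (prep_neq0 (P i)) => k0.
    by rewrite -[prep _]/(hcoord _) aP kE k0 scale0r.
  apply/mapP; exists i; rewrite ?mem_enum // bk.
  move: kE; rewrite bk scalerDr addrC => /addrI /eqP.
  rewrite scalerA -subr_eq0 -scalerBl scaler_eq0 (negPf u0) orbF subr_eq0.
  by move/eqP ->; rewrite mulrC mulKf.
exists (v + c *: u), u; split=> //;
  [by rewrite memvD ?memvZ ?PW | exact: PW | exact: Pe |].
move=> j; apply: contra c1; rewrite !mxE addr_eq0 => /eqP vj.
by apply/mapP; exists j; rewrite ?mem_enum // vj opprK mulfK ?P_neq0.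
Qed.

Lemma affine_coordinates : exists (z e : 'I_n.+1 -> K) (y t : 'I_r -> K),
  [/\ injective z, injective y, (forall j, e j != 0) /\ (forall i, t i != 0),
    (forall i j, y i != z j) /\ (forall i j, hcoord (P i) 0 j = pt z e y t i j)
    & exists c0 c1, forall j, q 0 j = e j * (c0 + c1 * z j)].
Proof.
have [e [u [eW uW ue e0 Pe]]] := chart.
have en0 : e != 0 by apply: contraNneq (e0 0) => ->; rewrite mxE.
have WE := plane_decomposition W2 eW uW en0 ue.
have /choice[a aP] i : exists ab : K * K, hcoord (P i) = ab.1 *: e + ab.2 *: u.
  by have [s [t st]] := WE _ (PW i); exists (s, t).
have t0 i : (a i).2 != 0.
  apply: contraNneq (Pe i) => a0; rewrite aP a0 scale0r addr0.
  by rewrite memvZ ?memv_line.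
pose z j := u 0 j / e 0 j; pose y i := - ((a i).1 / (a i).2).
have PE i j : hcoord (P i) 0 j = pt z (e 0) y (fun i => (a i).2) i j.
  by rewrite aP !mxE /pt /z /y; field; rewrite e0 t0.
exists z, (e 0), y, (fun i => (a i).2); split=> //.
(* If z_j = z_k, then u - z_j e has two zero coordinates, hence is zero, against the independence of
   [e] and [u]. *)
- move=> j k zjk; apply/eqP; apply: contraNT ue => jk.
  apply/vlineP; exists (z j); apply/eqP; rewrite -subr_eq0; apply/eqP.
  apply: (W_coord _ jk); rewrite ?memvB ?memvZ // !mxE.
    by rewrite /z divfK ?subrr.
  by rewrite zjk /z divfK ?subrr.
(* With equal [y], the coordinate vectors differ only by the ratio of their factors [t]. *)
- move=> i i' yE; apply: P_inj; apply: (@proj_eq _ _ _ _ ((a i).2 / (a i').2)).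
  apply/rowP => j; rewrite mxE; rewrite -![prep _]/(hcoord _) !PE /pt yE.
  by field; exact: t0.
- split=> // i j; have := P_neq0 i j; rewrite PE /pt mulf_eq0 negb_or subr_eq0.
  by case/andP => _; rewrite eq_sym.
have [s [t ->]] := WE _ qW; exists s, t => j.
by rewrite !mxE /z; field; exact: e0.
Qed.

Lemma sqfree_hadamard_star_configuration :
  hadamard_star_configuration (sqfree_hadamard n (range P)).
Proof.
have [z [e [y [t [z_inj y_inj [e0 t0] [yz PE] [c0 [c1 qE]]]]]]] :=
  affine_coordinates.
pose b := base_coef z e.
have b0 j : b j != 0 by apply: base_coef_neq0.
pose L i := lform (fun j => b j / hcoord (P i) 0 j).
have lcoefL i j : lcoef (L i) j = b j / hcoord (P i) 0 j by rewrite lcoef_lform.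
have L0 i : L i != 0.
  apply/eqP => /lform_eq0/(_ 0)/eqP; apply/negP.
  by rewrite mulf_neq0 ?invr_neq0.
(* The codimension is [n]: the points of the configuration are the common zeros of [n] of the
   forms. *)
exists n, r, L; split.
- by rewrite leqnn andbT ltnW.
- split=> //.
    (* The numerators [b j] are nonzero, so the coefficients of [L i] determine the coordinates of
       [P i]. *)
    move=> i i' LE; apply: P_inj; apply: (@proj_eq _ _ _ _ 1).
    rewrite scale1r; apply/rowP => j; apply/invr_inj/(mulfI (b0 j)).
    by rewrite -[LHS]lcoefL LE lcoefL.
  move=> I In; apply: free_map_uniq; first exact: enum_uniq.
  move=> c; rewrite lform_sum => /lform_eq0 cE.
  apply: (lform_free z_inj y_inj e0 t0 yz) (enum_uniq _) _ _.
    by rewrite -cardE.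
  by move=> j; rewrite -[RHS](cE j); apply: eq_bigr => i _; rewrite PE.
- exists (lform b), P; split.
    move=> i; split; first by apply/not_Delta_n1; rewrite // ltnW.
    have [C LC] := pclass_neq0 (L0 i); exists C => //.
    by rewrite -LC; congr pclass; apply: eq_bigr => j _; rewrite lcoef_lform.
  move=> i; rewrite -[RHS](sum_base_coef_pt y t z_inj e0 (q0 := c0) (q1 := c1) i n2).
    by apply: eq_bigr => j _; rewrite lcoef_lform PE.
  by move=> j; rewrite -qE q1.
apply/seteqP; split=> Q.
  move=> /sqfree_hadamard_range; case=> //; first by rewrite ltnW.
  move=> I In /pclass_Some[k k0 QE]; exists I => // i iI.
  apply/vanishes_lform.
  have := lform_at_prod_pt z_inj y_inj e0 t0 yz (s := enum I) (i := i).
  rewrite -cardE mem_enum => /(_ In iI) /(congr1 ( *%R k)).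
  rewrite -lform_atZ mulr0 => E0; rewrite -[RHS]E0; apply: eq_bigr => j _.
  rewrite -[hcoord Q]/(prep Q) QE !mxE PE; congr (_ * (_ * _)).
  by apply: eq_bigr => i' _; rewrite PE.
case=> I In IQ; apply/sqfree_hadamard_range => //; first by rewrite ltnW.
exists I => //.
(* Conversely, a common zero of the forms indexed by [I] is a multiple of the product vector; the
   factor is nonzero since [Q] is a point. *)
have [||i|k kE] := @common_zero_prod_pt _ _ _ z e y t z_inj y_inj e0 t0 yz
   (enum I) (hcoord Q 0).
- by rewrite -cardE.
- exact: enum_uniq.
- rewrite mem_enum => /IQ/vanishes_lform QE; rewrite -[RHS]QE.
  by apply: eq_bigr => j _; rewrite PE.
have QE : prep Q = k *: (\row_j \prod_(i <- enum I) hcoord (P i) 0 j).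
  apply/rowP => j; rewrite -[prep _]/(hcoord _) kE !mxE; congr (_ * _).
  by apply: eq_bigr => i _; rewrite PE.
apply/pclass_Some; exists k => //.
by apply: contraNneq (prep_neq0 Q) => k0; rewrite QE k0 scale0r.
Qed.

End PointsOnLine.

(** * Both cases of the theorem *)

Theorem theorem2p17 (R : realType) (n : nat) (hn : (2 <= n)%N)
    (l : set (pspace R[i] n)) (hl : is_line l)
    (hlD : l `&` Delta (n - 2)%N = set0)
    (m : nat) (hm : (n < m)%N)
    (X : set (pspace R[i] n)) (hXm : (X #= `I_m)%card) (hXl : X `<=` l)
    (hXD : X `&` Delta (n - 1)%N = set0) :
  (l (pones R[i] n) -> hadamard_star_configuration (sqfree_hadamard n X)) /\
  (n = 2%N -> hadamard_star_configuration (sqfree_hadamard 2 X)).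
Proof.
have [W W2 lE] := hl.
(* A nonzero vector of [W] with two zero coordinates would give a point of the line in
   Delta_(n-2). *)
have W_coord w j k : w \in W -> j != k -> w 0 j = 0 -> w 0 k = 0 -> w = 0.
  move=> wW jk wj wk; apply: contrapT => /eqP /pclass_neq0[A /pclass_Some[a a0 AE]].
  have lA : l A by rewrite lE /= psub_prep -memvE AE memvZ.
  have nA : ~ Delta (n - 2) A.
    by move=> dA; have : (l `&` Delta (n - 2)) A by []; rewrite hlD.
  have := not_Delta_n2 hn nA jk; rewrite -[hcoord A]/(prep A) AE !mxE wj wk mulr0.
  by move=> /(_ erefl); rewrite eqxx.
have [P P_inj PX] := enum_card_eq hXm.
have PW i : hcoord (P i) \in W.
  have /hXl : X (P i) by rewrite PX; exists i.
  by rewrite lE /= psub_prep -memvE.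
have P_neq0 i j : hcoord (P i) 0 j != 0.
  have XP : X (P i) by rewrite PX; exists i.
  move: j; apply/not_Delta_n1; first by rewrite ltnW.
  by move=> dP; have : (X `&` Delta (n - 1)) (P i) by []; rewrite hXD.
split=> [l1|n2].
  rewrite PX.
  apply: (sqfree_hadamard_star_configuration hn hm W2 W_coord P_inj PW P_neq0
    (q := const_mx 1)).
    by move: l1; rewrite lE /= -memvE.
  by move=> j; rewrite mxE expr1n.
(* Here the exponent n - 2 is 0, so any vector of the plane serves as [q]; the first given point
   provides one. *)
subst n; rewrite PX.
have q_in := PW (Ordinal hm).
exact: (sqfree_hadamard_star_configuration _ hm W2 W_coord P_inj PW P_neq0 q_in).
Qed.
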